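(* For every pair of real numbers $a<b$ and every $r>0$, $$g(a-r,b+r)-g(a,b)\geq \frac r2 .$$ If $\mu(a,b)<1/2$, then $$g(a-r,b+r)-g(a,b)\geq r$$ for all $r>0$ which are small enough (i.e. there is $r_0>0$, depending on $a,b$, such that it holds for all $0<r\le r_0$). In particular, for $0<r\leq 2/\sqrt{3}$ the inequality $g(a-r,b+r)-g(a,b)\geq r$ holds whenever $\mu(a,b)<1/3$.
   Context: $\mu$ is the standard Cauchy probability measure on $\mathbb{R}$, with density $f(x)=\frac{1}{\pi(1+x^2)}$; $\mu(a,b)$ denotes the measure of the interval $(a,b)$. For real $a<b$, $g(a,b)$ is the unique real number with $\mu(-\infty,g(a,b))=\mu(a,b)$. *)

(* Defs.v *)
From HB Require Import structures.
From mathcomp Require Import all_boot all_order all_algebra.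
From mathcomp Require Import all_classical all_reals all_analysis measurable_realfun.

Set Implicit Arguments.
Unset Strict Implicit.
Unset Printing Implicit Defensive.

Import Order.TTheory GRing.Theory Num.Theory.
Import numFieldNormedType.Exports.

Local Open Scope classical_set_scope.
Local Open Scope ring_scope.

Section cauchy_pdf.
Context {R : realType}.

Definition cauchy_pdf (x : R) : R := 1 / (pi * (1 + x ^+ 2)).

Lemma cauchy_pdfE x : cauchy_pdf x = pi^-1 * (oneDsqr x)^-1.
Proof. by rewrite /cauchy_pdf div1r invfM. Qed.

Lemma cauchy_pdf_ge0 x : 0 <= cauchy_pdf x.
Proof.
by rewrite cauchy_pdfE mulr_ge0// invr_ge0 pi_ge0.
Qed.

Lemma continuous_cauchy_pdf : continuous cauchy_pdf.
Proof.
rewrite (_ : cauchy_pdf = fun x => pi^-1 * (oneDsqr x)^-1); last first.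
  by apply/funext => x; rewrite cauchy_pdfE.
by move=> x; apply: cvgM; [exact: cvg_cst|exact: continuous_oneDsqrV].
Qed.

Lemma measurable_cauchy_pdf : measurable_fun [set: R] cauchy_pdf.
Proof.
by apply: continuous_measurable_fun; exact: continuous_cauchy_pdf.
Qed.

Lemma integral_cauchy_pdf :
  (\int[lebesgue_measure]_x (cauchy_pdf x)%:E = 1)%E.
Proof.
rewrite ge0_symfun_integralT//=; last 3 first.
- exact: cauchy_pdf_ge0.
- exact: continuous_cauchy_pdf.
- by move=> x; rewrite /= /cauchy_pdf sqrrN.
rewrite (_ : [set x | 0 <= x] = `[0%R, +oo[%classic); last first.
  by apply/seteqP; split => x /=; rewrite in_itv/= andbT.
under eq_integral do rewrite cauchy_pdfE EFinM.
rewrite ge0_integralZl//=.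
- rewrite integral0y_oneDsqr -!EFinM.
  by rewrite mulKf ?gt_eqF ?pi_gt0// divff.
- apply/measurable_EFinP; apply: measurable_funTS.
  by apply: continuous_measurable_fun; exact: continuous_oneDsqrV.
- by rewrite lee_fin invr_ge0 pi_ge0.
Qed.

End cauchy_pdf.

Definition cauchy_prob {R : realType} : set R -> \bar R :=
  fun V => (\int[lebesgue_measure]_(x in V) (cauchy_pdf x)%:E)%E.

Section cauchy_prob.
Context {R : realType}.

Local Notation cauchy := (@cauchy_prob R).

Let cauchy0 : cauchy set0 = 0%E.
Proof. by rewrite /cauchy_prob integral_set0. Qed.

Let cauchy_ge0 A : (0 <= cauchy A)%E.
Proof.
by apply: integral_ge0 => x _; rewrite lee_fin cauchy_pdf_ge0.
Qed.

Let cauchy_sigma_additive : semi_sigma_additive cauchy.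
Proof.
move=> /= F mF tF mUF; rewrite /cauchy_prob; apply: cvg_toP.
  apply: ereal_nondecreasing_is_cvgn => m n mn.
  apply: lee_sum_nneg_natr => // k _ _; apply: integral_ge0 => /= x Fkx.
  by rewrite lee_fin cauchy_pdf_ge0.
rewrite ge0_integral_bigcup//=.
- apply/measurable_funTS/measurableT_comp => //.
  exact: measurable_cauchy_pdf.
- by move=> x _; rewrite lee_fin cauchy_pdf_ge0.
Qed.

HB.instance Definition _ := isMeasure.Build _ _ _
  cauchy cauchy0 cauchy_ge0 cauchy_sigma_additive.

Let cauchy_setT : cauchy [set: R] = 1%E.
Proof. exact: integral_cauchy_pdf. Qed.

HB.instance Definition _ :=
  @Measure_isProbability.Build _ _ R cauchy cauchy_setT.

End cauchy_prob.

(* The unique real [y] with mu(-oo, y) = mu(a, b).  For [a < b] it exists and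
   is unique because the cumulative distribution function of [cauchy_prob] is
   a continuous increasing bijection from R onto ]0, 1[.  For [b <= a] no such
   real exists and [get] returns a default value. *)
Definition cauchy_g {R : realType} (a b : R) : R :=
  get [set y : R | cauchy_prob `]-oo, y[ = cauchy_prob `]a, b[].

(* Main.v *)
Require Import Defs.
From mathcomp Require Import all_boot all_order all_algebra.
From mathcomp Require Import all_classical all_reals all_analysis.
From mathcomp Require Import measurable_realfun ring lra.

Import Order.TTheory GRing.Theory Num.Theory.
Import numFieldNormedType.Exports.

Local Open Scope classical_set_scope.
Local Open Scope ring_scope.

(* With F(x) = 1/2 + atan(x)/pi the distribution function, the equation
   F(y) = F(b) - F(a) reads y = - cot (atan b - atan a), so the addition formula
   for cot gives the rational function g(a, b) = - (1 + a b) / (b - a).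
   In terms of the length s = b - a and the centre c = (a + b) / 2 this is
   g = s/4 - (1 + c^2)/s.  Passing to (a - r, b + r) keeps c and turns s into
   s + 2 r, which adds r/2 + (1 + c^2) (1/s - 1/(s + 2 r)); this increment is at
   least r exactly when s (s + 2 r) <= 4 (1 + c^2).  The hypotheses mu(a,b) < 1/2
   and mu(a,b) < 1/3 mean g < 0 and g < - 1/sqrt 3, that is,
   s^2 < 4 (1 + c^2) and s^2 + 4 s / sqrt 3 < 4 (1 + c^2). *)

Lemma is_derive_atan_pi (R : realType) (x : R) :
  is_derive x 1 (fun y : R => pi^-1 * atan y) (cauchy_pdf x).
Proof.
have -> : cauchy_pdf x = pi^-1 *: (1 + x ^+ 2)^-1 by rewrite cauchy_pdfE.
exact: is_deriveZ.
Qed.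

Lemma continuous_atan_pi (R : realType) : continuous (fun y : R => pi^-1 * atan y).
Proof. by move=> x; apply: cvgM; [exact: cvg_cst|exact: continuous_atan]. Qed.

Lemma cauchy_prob_itvoo (R : realType) (a b : R) : a < b ->
  cauchy_prob `]a, b[ = (pi^-1 * (atan b - atan a))%:E.
Proof.
move=> ab; rewrite /cauchy_prob.
have mf (A : set R) : measurable_fun A (@cauchy_pdf R).
  by apply: measurable_funTS; exact: measurable_cauchy_pdf.
(* The endpoints are null, so the interval may be closed to suit the fundamental theorem of
   calculus. *)
rewrite integral_itv_obnd_cbnd; last exact/measurable_EFinP.
rewrite integral_itv_bndo_bndc; last exact/measurable_EFinP.
rewrite (@continuous_FTC2 _ _ (fun y : R => pi^-1 * atan y))//.
- by rewrite mulrBr EFinB.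
- by apply: continuous_subspaceT => x; exact: continuous_cauchy_pdf.
- split.
  + by move=> x _; have [] := is_derive_atan_pi R x.
  + by apply: cvg_at_right_filter; exact: continuous_atan_pi.
  + by apply: cvg_at_left_filter; exact: continuous_atan_pi.
- by move=> x _; rewrite derive1E; have [] := is_derive_atan_pi R x.
Qed.

(** Obtained by complement from the upper tail, where the primitive [pi^-1 * atan y] tends to 1/2 at
    infinity. *)
Lemma cauchy_prob_itvNyo (R : realType) (y : R) :
  cauchy_prob `]-oo, y[ = (1 / 2 + pi^-1 * atan y)%:E.
Proof.
have pi0 : (pi : R) != 0 by rewrite gt_eqF// pi_gt0.
have tail : cauchy_prob `[y, +oo[ = (1 / 2 - pi^-1 * atan y)%:E.
  rewrite /cauchy_prob.
  rewrite (@ge0_continuous_FTC2y _ _ (fun y : R => pi^-1 * atan y) _ (1 / 2)).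
  - by rewrite EFinB.
  - by move=> x _; exact: cauchy_pdf_ge0.
  - by apply: continuous_subspaceT => x; exact: continuous_cauchy_pdf.
  - have -> : 1 / 2 = pi^-1 * (pi / 2) :> R by rewrite mulKf// div1r.
    by apply: cvgM; [exact: cvg_cst|exact: cvgy_atan].
  - by move=> x _; have [] := is_derive_atan_pi R x.
  - by apply: cvg_at_right_filter; exact: continuous_atan_pi.
  - by move=> x _; rewrite derive1E; have [] := is_derive_atan_pi R x.
have -> : `]-oo, y[%classic = ~` `[y, +oo[%classic by rewrite setCitvr.
rewrite (probability_setC cauchy_prob)//=.
by rewrite tail -EFinB; congr (_%:E); lra.
Qed.

(** Since tan (t - pi/2) = - cot t, this is the addition formula for cot. As 0 < atan b - atan a <
    pi, the shifted angle lies where [atan] inverts [tan]. *)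
Lemma atan_cotB (R : realType) (a b : R) : a < b ->
  atan (- (1 + a * b) / (b - a)) = atan b - atan a - pi / 2.
Proof.
move=> ab.
have ba0 : b - a != 0 by rewrite subr_eq0 gt_eqF.
have cos0 (x : R) : cos (atan x) != 0.
  by rewrite gt_eqF// cos_gt0_pihalf// atan_gtNpi2 atan_ltpi2.
have sinE (x : R) : sin (atan x) = x * cos (atan x).
  by rewrite -[X in X * _]atanK /tan divfK.
rewrite -[RHS]tanK.
  rewrite /tan sinBpihalf cosBpihalf cosB sinB !sinE; congr atan.
  (* With the sines eliminated, only a rational identity in the nonzero cosines [p], [q] remains. *)
  move: (cos (atan a)) (cos (atan b)) (cos0 a) (cos0 b) => p q p0 q0.
  have -> : b * q * p - q * (a * p) = (b - a) * (p * q) by ring.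
  by field; rewrite ba0 p0 q0.
have := lt_atan ab; have := atan_ltpi2 b; have := atan_gtNpi2 a.
by rewrite in_itv/= => *; apply/andP; split; lra.
Qed.

Lemma cauchy_prob_itvooE (R : realType) (a b : R) : a < b ->
  cauchy_prob `]a, b[ = cauchy_prob `]-oo, - (1 + a * b) / (b - a)[.
Proof.
move=> ab; rewrite cauchy_prob_itvoo// cauchy_prob_itvNyo atan_cotB//.
have pi0 : (pi : R) != 0 by rewrite gt_eqF// pi_gt0.
by congr (_%:E); move: (pi : R) pi0 => p p0; field.
Qed.

Lemma ltr_atan (R : realType) : {mono @atan R : x y / x < y}.
Proof. exact: (leW_mono (le_mono (@lt_atan R))). Qed.

(** Serves both the uniqueness of g and the translation of bounds on mu(a,b) into bounds on
    g(a,b). *)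
Lemma cauchy_prob_itvNyo_lt (R : realType) (x y : R) :
  (cauchy_prob `]-oo, x[ < cauchy_prob `]-oo, y[)%E = (x < y).
Proof.
by rewrite !cauchy_prob_itvNyo lte_fin ltrD2l ltr_pM2l ?invr_gt0 ?pi_gt0// ltr_atan.
Qed.

Lemma cauchy_gE (R : realType) (a b : R) : a < b ->
  cauchy_g a b = - (1 + a * b) / (b - a).
Proof.
move=> ab; apply: get_unique => [|y]; first by rewrite /= cauchy_prob_itvooE.
rewrite /= cauchy_prob_itvooE// => yE.
by apply/eqP; rewrite eq_le !leNgt -!cauchy_prob_itvNyo_lt yE ltxx.
Qed.

Lemma cauchy_gB (R : realType) (a b r : R) : a < b -> 0 < r ->
  cauchy_g (a - r) (b + r) - cauchy_g a b =
  r / 2 + 2 * r * (1 + ((a + b) / 2) ^+ 2) / ((b - a) * (b - a + 2 * r)).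
Proof.
move=> ab r0; rewrite !cauchy_gE//; last lra.
by field; apply/andP; split; rewrite gt_eqF//; lra.
Qed.

Lemma cauchy_gB_ge (R : realType) (a b r : R) : a < b -> 0 < r ->
  (r <= cauchy_g (a - r) (b + r) - cauchy_g a b) =
  ((b - a) * (b - a + 2 * r) <= 4 + (a + b) ^+ 2).
Proof.
move=> ab r0; rewrite cauchy_gB// -lerBlDl.
have -> : r - r / 2 = r / 2 :> R by field.
rewrite ler_pdivlMr; last by rewrite mulr_gt0//; lra.
have -> : 2 * r * (1 + ((a + b) / 2) ^+ 2) = (r / 2) * (4 + (a + b) ^+ 2) by field.
by rewrite ler_pM2l// divr_gt0.
Qed.

Lemma atan_sqrt3V (R : realType) : atan (Num.sqrt 3)^-1 = pi / 6 :> R.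
Proof.
have pi0 : 0 < pi :> R := pi_gt0 R.
have s0 : 0 < sin (pi / 6) :> R by apply: sin_gt0_pi; apply/andP; split; lra.
have c0 : 0 < cos (pi / 6) :> R by apply: cos_gt0_pihalf; apply/andP; split; lra.
have sE : sin (pi / 6) = 1 / 2 :> R.
  (* cos (pi/3) = sin (pi/6) turns the double angle formula into
     2 sin^2 + sin = 1 *)
  have : cos (pi / 6 + pi / 6) = sin (pi / 6) :> R.
    by rewrite -[RHS]cosBpihalf -[RHS]cosN; congr cos; lra.
  rewrite cosD -!expr2 cos2sin2; nra.
have cE : cos (pi / 6) = Num.sqrt 3 / 2 :> R.
  apply/eqP; rewrite -(@eqrXn2 _ 2)// ?ltW// ?divr_ge0 ?sqrtr_ge0//.
  by rewrite expr_div_n sqr_sqrtr// cos2sin2 sE; apply/eqP; field.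
have q0 : Num.sqrt 3 != 0 :> R by rewrite gt_eqF// sqrtr_gt0.
have -> : (Num.sqrt 3)^-1 = tan (pi / 6) :> R by rewrite /tan sE cE; field.
by rewrite tanK// in_itv/=; apply/andP; split; lra.
Qed.

Theorem theorem3 (R : realType) :
  (forall a b r : R, a < b -> 0 < r ->
     r / 2 <= cauchy_g (a - r) (b + r) - cauchy_g a b) /\
  (forall a b : R, a < b -> (cauchy_prob `]a, b[ < (1 / 2)%:E)%E ->
     exists2 r0 : R, 0 < r0 &
       forall r : R, 0 < r <= r0 ->
         r <= cauchy_g (a - r) (b + r) - cauchy_g a b) /\
  (forall a b r : R, a < b -> 0 < r <= 2 / Num.sqrt 3 ->
     (cauchy_prob `]a, b[ < (1 / 3)%:E)%E ->
     r <= cauchy_g (a - r) (b + r) - cauchy_g a b).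
Proof.
have pi0 : (pi : R) != 0 by rewrite gt_eqF// pi_gt0.
split; last split.
- move=> a b r ab r0; rewrite cauchy_gB// lerDl divr_ge0//.
    by rewrite mulr_ge0 ?addr_ge0 ?sqr_ge0// mulr_ge0// ltW.
  by rewrite mulr_ge0//; lra.
- move=> a b ab.
  have -> : (1 / 2)%:E = cauchy_prob `]-oo, (0 : R)[.
    by rewrite cauchy_prob_itvNyo atan0 mulr0 addr0.
  rewrite cauchy_prob_itvooE// cauchy_prob_itvNyo_lt ltr_pdivrMr ?subr_gt0//.
  rewrite mul0r => ab1.
  (* As (a + b)^2 - (b - a)^2 = 4 a b, the criterion of [cauchy_gB_ge] reads (b - a) r <= 2 (1 + a
     b), so this is the exact threshold; it is positive because g < 0 gives 1 + a b > 0. *)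
  exists (2 * (1 + a * b) / (b - a)) => [|r /andP[r0]].
    by rewrite divr_gt0 ?subr_gt0//; lra.
  rewrite ler_pdivlMr ?subr_gt0// cauchy_gB_ge// => rab.
  nra.
- move=> a b r ab /andP[r0 r3].
  (* Here 1/3 = 1/2 - (pi/6)/pi. *)
  have -> : (1 / 3)%:E = cauchy_prob `]-oo, - (Num.sqrt 3)^-1[ :> \bar R.
    rewrite cauchy_prob_itvNyo atanN atan_sqrt3V; congr (_%:E).
    by move: (pi : R) pi0 => p p0; field.
  rewrite cauchy_prob_itvooE// cauchy_prob_itvNyo_lt ltr_pdivrMr ?subr_gt0//.
  move=> ab3; rewrite cauchy_gB_ge//.
  (* By [ab3] the right side is below 2 (1 + a b), the same threshold as before. *)
  have : (b - a) * r <= (b - a) * (2 / Num.sqrt 3) by rewrite ler_pM2l// subr_gt0.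
  nra.
Qed.
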